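(* Let $n$ and $k$ be integers with $0\le k\le n$. If $X_1,\ldots,X_{k+1}\subset\mathbb R^n$ are $(n-k)$-convex compact sets and $0\in\operatorname{conv}X_i$ for every $i=1,\ldots,k+1$, then $0\in X_1*X_2*\cdots*X_{k+1}$.
   Context: A compact set $X\subset\mathbb R^n$ is called $m$-convex if for every linear map $A:\mathbb R^n\to\mathbb R^m$ the image $A(X)$ is convex (for $m=0$ this is automatic). For $A,B\subset\mathbb R^n$ the geometric join is $A*B=\{ta+(1-t)b: a\in A,\ b\in B,\ t\in[0,1]\}$; the iterated join $X_1*\cdots*X_{k+1}$ equals the set of all convex combinations $t_1x_1+\cdots+t_{k+1}x_{k+1}$ with $x_i\in X_i$, $t_i\ge0$, $\sum t_i=1$. *)

(* Defs.v *)
From HB Require Import structures.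
From mathcomp Require Import all_boot all_order all_algebra.
From mathcomp Require Import all_classical all_reals all_analysis.
Set Implicit Arguments. Unset Strict Implicit. Unset Printing Implicit Defensive.
Import Order.TTheory GRing.Theory Num.Theory.
Import numFieldNormedType.Exports.
Local Open Scope classical_set_scope.
Local Open Scope ring_scope.

Definition convexS (R : realType) (m : nat) (S : set 'rV[R]_m) : Prop :=
  forall x y (t : R), S x -> S y -> 0 <= t -> t <= 1 ->
    S (t *: x + (1 - t) *: y).

Definition m_convex (R : realType) (n m : nat) (X : set 'rV[R]_n) : Prop :=
  forall f : {linear 'rV[R]_n -> 'rV[R]_m}, convexS (f @` X).

Definition conv_hull (R : realType) (n : nat) (X : set 'rV[R]_n) : set 'rV[R]_n :=
  [set z | exists (p : nat) (t : 'I_p -> R) (x : 'I_p -> 'rV[R]_n),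
     [/\ forall i, 0 <= t i, \sum_(i < p) t i = 1, forall i, X (x i)
       & z = \sum_(i < p) t i *: x i]].

Definition join (R : realType) (n q : nat) (X : 'I_q -> set 'rV[R]_n) : set 'rV[R]_n :=
  [set z | exists (t : 'I_q -> R) (x : 'I_q -> 'rV[R]_n),
     [/\ forall i, 0 <= t i, \sum_(i < q) t i = 1, forall i, X i (x i)
       & z = \sum_(i < q) t i *: x i]].

(* Main.v *)
Require Import Defs.
From HB Require Import structures.
From mathcomp Require Import all_boot all_order all_algebra.
From mathcomp Require Import zify lra ring.
Set Implicit Arguments. Unset Strict Implicit. Unset Printing Implicit Defensive.

(** Let [p = \sum_i t_i x_i] be a point of the join of least Euclidean norm and
    suppose [p != 0].  Minimality forces every [t_i] to be positive (otherwise
    the unused [x_i] could be replaced by a point of [X_i] in the half-space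
    [<y, p> <= 0]), hence the [x_i] are affinely independent.  The span of the
    differences [x_i - x_0] is then the kernel of a linear map to [R^(n-k)], so
    by [(n-k)]-convexity it contains a point [y_i] of each [X_i].  Write
    [y_j = \sum_i A_ij x_i] with [\sum_i A_ij = 0].  A symmetric equilibrium [z]
    of the matrix [A_ij / t_i], with value [s >= 0], yields weights [w_i >= 0]
    with [w_i z_i = 0], [\sum_i w_i = s] and
    [\sum_i (w_i x_i + z_i y_i) = s p], so the shorter vector [s / (1 + s) p] is
    in the join: a contradiction.

    The equilibrium is obtained from Scarf's combinatorial lemma applied to the
    lattice points of a dilated simplex, and a compactness argument. *)

(** * Scarf's lemma *)

Section Scarf.
Variables (T I : finType) (r : I -> T -> nat) (c : T -> I) (x0 : T) (i0 : I).
Hypothesis r_inj : forall i, injective (r i).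
Implicit Types (s : {set T}) (C : {set I}).

(** Scarf's dominance: no point of [T] lies strictly above the [r i]-minimum of a nonempty [s] for
    all [i] in [C] at once. For empty [s] it only says that [C] is nonempty. *)
Definition dominant s C :=
  [forall y, [exists i in C, [forall x in s, r i y <= r i x]]].

Lemma dominantP s C :
  reflect (forall y, exists2 i, i \in C & forall x, x \in s -> r i y <= r i x)
          (dominant s C).
Proof.
apply: (iffP forallP) => H y.
  by have /exists_inP[i iC /forall_inP h] := H y; exists i.
by have [i iC h] := H y; apply/exists_inP; exists i => //; apply/forall_inP.
Qed.

Lemma dominant_mono s s' C C' :
  s \subset s' -> C' \subset C -> dominant s' C' -> dominant s C.
Proof.
move=> /subsetP ss /subsetP CC /dominantP H; apply/dominantP => y.
have [i /CC iC h] := H y; exists i => // x /ss; exact: h.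
Qed.

Lemma argmin_ex s i : s != set0 ->
  exists2 x, x \in s & forall y, y \in s -> r i x <= r i y.
Proof.
by case/set0Pn => x xs; case: (arg_minnP (r i) xs) => z zs h; exists z.
Qed.

(** * The two rooms of a door *)

Section Door.
Variables (s : {set T}) (C : {set I}) (m : I -> T).
Hypotheses (m_in : forall i, m i \in s)
  (m_min : forall i x, x \in s -> r i (m i) <= r i x).

Lemma argmin_unique i x : x \in s -> r i x <= r i (m i) -> x = m i.
Proof.
by move=> xs le; apply: (@r_inj i); apply/eqP; rewrite eqn_leq le m_min.
Qed.

(** Dominance tested at a point of [s] itself yields an index at which that point is minimal in
    [s]. *)
Lemma dominant_argmin C' : dominant s C' -> m @: C' = s.
Proof.
move=> /dominantP H; apply/eqP; rewrite eqEsubset; apply/andP; split.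
  by apply/subsetP => _ /imsetP[i _ ->].
apply/subsetP => x xs; have [i iC h] := H x; apply/imsetP; exists i => //.
by apply: argmin_unique => //; apply: h.
Qed.

(** For [i] in [C], these are the points that only the order [i] can keep from beating all minima of
    [s], so they obstruct dominance once [i] is dropped. *)
Definition above i := [set y | [forall k in C :\ i, r k (m k) < r k y]].

Lemma aboveP i y :
  reflect (forall k, k \in C :\ i -> r k (m k) < r k y) (y \in above i).
Proof. by rewrite inE; apply: forall_inP. Qed.

Lemma dominant_above0 i : dominant s (C :\ i) = (above i == set0).
Proof.
apply/dominantP/eqP => [H|H y].
  apply/setP => y; rewrite [RHS]inE; apply/negP => /aboveP h.
  have [k /h + /(_ _ (m_in k))] := H y; lia.
have : y \notin above i by rewrite H inE.
rewrite inE => /forall_inPn[k kC]; rewrite -leqNgt => h.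
by exists k => // x /(m_min k); apply: leq_trans.
Qed.

(** Points of [above i] are blocked by [i], where [x] becomes the new minimum. Any other point is
    blocked at some [k] other than [i], where [x] exceeds the old minimum and so leaves it
    unchanged. *)
Lemma dominant_above i x : i \in C -> dominant s C -> x \in above i ->
  (forall y, y \in above i -> r i y <= r i x) -> dominant (x |: s) C.
Proof.
move=> iC /dominantP H xa xmax; apply/dominantP => y.
have xi : r i x <= r i (m i).
  have [k kC h] := H x; have [->|ki] := eqVneq i k; first exact: h.
  by move/aboveP: xa => /(_ k); rewrite !inE eq_sym ki kC => /(_ isT);
    have := h _ (m_in k); lia.
have [/xmax yx|] := boolP (y \in above i).
  exists i => // z /setU1P[->//|/(m_min i)]; lia.
rewrite inE => /forall_inPn[k kC]; rewrite -leqNgt => h.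
exists k => [|z /setU1P[->|/(m_min k)]]; first by case/setD1P: kC.
  by have := aboveP _ _ xa k kC; lia.
exact: leq_trans.
Qed.

Lemma above_max i x : i \in C -> x \in above i -> dominant (x |: s) C ->
  forall y, y \in above i -> r i y <= r i x.
Proof.
move=> iC xa /dominantP H y ya; have [k kC h] := H y.
have [ik|ki] := eqVneq i k; first by rewrite ik; apply: h; rewrite !inE eqxx.
have kCi : k \in C :\ i by rewrite !inE eq_sym ki.
by have := aboveP _ _ ya k kCi; have := h (m k);
  rewrite inE m_in orbT => /(_ isT); lia.
Qed.

Lemma above_notin i x : m @: (C :\ i) = s -> x \in above i -> x \notin s.
Proof.
move=> ms /aboveP xa; apply/negP; rewrite -ms => /imsetP[k kC xk].
by have := xa _ kC; rewrite xk ltnn.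
Qed.

(** A common point would beat the minimum of [s] in every order of [C]. *)
Lemma above2 i j x : i != j -> dominant s C -> x \in above i -> x \notin above j.
Proof.
move=> ij /dominantP H /aboveP xi; apply/negP => /aboveP xj.
have [k kC /(_ _ (m_in k))] := H x; have [ki|ki] := eqVneq k i.
  by have := xj k; rewrite !inE kC ki ij => /(_ isT); lia.
by have := xi k; rewrite !inE kC ki => /(_ isT); lia.
Qed.

(** Converse to [dominant_above]. Let [G] collect the indices at which [x] exceeds the minimum of
    [s]. Dominance at the points of [s] makes [m] map [G] onto [s], while the index blocking [x] is
    not in [G]; counting leaves exactly one index outside [G]. *)
Lemma dominant_setU1_above x :
  #|C| = #|s|.+1 -> x \notin s -> dominant (x |: s) C ->
  exists2 i, i \in C & (x \in above i) /\ m @: (C :\ i) = s.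
Proof.
move=> cardC xs /dominantP H; have [i iC hi] := H x.
pose G := [set k in C | r k (m k) < r k x].
have mG : m @: G = s.
  apply/eqP; rewrite eqEsubset; apply/andP; split.
    by apply/subsetP => _ /imsetP[k _ ->].
  apply/subsetP => z zs; have [k kC hk] := H z.
  have zk : z = m k by apply: argmin_unique => //; apply: hk; rewrite inE m_in orbT.
  apply/imsetP; exists k => //; rewrite inE kC -zk /= ltn_neqAle hk ?setU11// andbT.
  by apply: contraNneq xs => /r_inj <-.
have iG : i \notin G by rewrite inE iC /= -leqNgt hi// inE m_in orbT.
have GE : G = C :\ i.
  apply/eqP; rewrite eqEcard; apply/andP; split.
    apply/subsetP => k kG; rewrite !inE; apply/andP; split.
      by apply: contraNneq iG => <-.
    by move: kG; rewrite inE => /andP[].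
  move: (cardsD1 i C); rewrite iC cardC add1n => -[<-]; rewrite -mG;
    exact: leq_imset_card.
exists i => //; split; last by rewrite -GE.
by apply/aboveP => k; rewrite -GE inE => /andP[].
Qed.

(** By cardinality [m] is injective on [C :\ k], so [i] and [j] cannot both survive there. *)
Lemma argmin_collision i j k : i != j -> i \in C -> j \in C -> k \in C ->
  #|C| = #|s|.+1 -> m i = m j -> m @: (C :\ k) = s -> (k == i) || (k == j).
Proof.
move=> ij iC jC kC cardC mij mk.
have /imset_injP inj : #|m @: (C :\ k)| == #|C :\ k|.
  by have := cardsD1 k C; rewrite kC mk cardC add1n => -[->].
apply: contraNT ij; rewrite negb_or ![k == _]eq_sym => /andP[ki kj].
by apply/eqP/inj; rewrite ?inE ?ki ?kj.
Qed.

Lemma imset_argmin_collision i j : i != j -> i \in C -> j \in C ->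
  m i = m j -> dominant s C -> m @: (C :\ i) = s.
Proof.
move=> ij iC jC mij /dominant_argmin <-; apply/eqP;
  rewrite eqEsubset imsetS ?subD1set//=.
apply/subsetP => _ /imsetP[k kC ->]; have [->|ki] := eqVneq k i.
  by rewrite mij imset_f// !inE eq_sym ij.
by rewrite imset_f// !inE ki.
Qed.

Lemma argmin_collision_ex : #|C| = #|s|.+1 ->
  exists i j, [/\ i != j, i \in C, j \in C & m i = m j].
Proof.
move=> cardC.
have : ~~ [forall i in C, forall j in C, (m i == m j) ==> (i == j)].
  apply/negP => /forall_inP inj.
  have /card_in_imset : {in C &, injective m}.
    by move=> i j /inj/forall_inP ij /ij/implyP h /eqP/h/eqP.
  have : #|m @: C| <= #|s|.
    by apply/subset_leq_card/subsetP => _ /imsetP[i _ ->].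
  by lia.
case/forall_inPn => i iC /forall_inPn[j jC];
  rewrite negb_imply => /andP[/eqP mij ij].
by exists i, j.
Qed.

(* Dropping [i] from [C] either leaves a dominant pair, or the points that
   beat [s] in every order of [C :\ i] have an [i]-largest one, which is added
   to [s]. *)
Definition room_at i : {set T} * {set I} :=
  if [pick x in above i | [forall y in above i, r i y <= r i x]] is Some x
  then (x |: s, C) else (s, C :\ i).

Variant room_at_spec i : {set T} * {set I} -> Type :=
| RoomAdd x of x \in above i & (forall y, y \in above i -> r i y <= r i x) :
    room_at_spec i (x |: s, C)
| RoomDrop of above i = set0 : room_at_spec i (s, C :\ i).

Lemma room_atP i : room_at_spec i (room_at i).
Proof.
rewrite /room_at; case: pickP => [x /andP[xa /forall_inP h]|no].
  exact: RoomAdd.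
apply: RoomDrop; apply/eqP/negPn/negP => /set0Pn[x xa].
have [z za zmax] := arg_maxnP (r i) xa.
by have /negP[] := negbT (no z); apply/andP; split=> //; apply/forall_inP.
Qed.

End Door.

(** The map [m] sends [C] onto [s] with one index in excess, so a single pair [i], [j] collides.
    Every adjacent dominant pair is [room_at k] for some [k] whose removal keeps [m] onto [s], and
    such a [k] is [i] or [j]. *)
Lemma rooms_of_door s C : s != set0 -> dominant s C -> #|C| = #|s|.+1 ->
  exists a b : {set T} * {set I}, a != b /\
    forall q, (q == a) || (q == b) =
      dominant q.1 q.2 && ([exists x, (x \notin s) && (q == (x |: s, C))]
                       || [exists i, (i \in C) && (q == (s, C :\ i))]).
Proof.
move=> s0 dom cardC.
have /fin_all_exists[m mP] : forall i, exists x,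
    x \in s /\ forall y, y \in s -> r i x <= r i y.
  by move=> i; have [x xs h] := argmin_ex i s0; exists x.
have m_in i : m i \in s by case: (mP i).
have m_min i x : x \in s -> r i (m i) <= r i x by case: (mP i) => _; apply.
have [i [j [ij iC jC mij]]] := argmin_collision_ex m_in cardC.
have pair := argmin_collision ij iC jC _ cardC mij.
have mi := imset_argmin_collision m_in m_min ij iC jC mij dom.
have mj : m @: (C :\ j) = s
  by apply: (imset_argmin_collision m_in m_min (i := j) (j := i)) => //;
  rewrite eq_sym.
have room k : k \in C -> m @: (C :\ k) = s ->
    dominant (room_at s C m k).1 (room_at s C m k).2
    && ([exists x, (x \notin s) && (room_at s C m k == (x |: s, C))]
       || [exists i, (i \in C) && (room_at s C m k == (s, C :\ i))]).
  move=> kC mk; case: room_atP => [x xa xmax|a0] /=.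
    rewrite (dominant_above m_in m_min kC) //=; apply/orP; left; apply/existsP;
      exists x.
    by rewrite eqxx (above_notin mk xa).
  rewrite (dominant_above0 C m_in m_min) a0 eqxx /=; apply/orP; right;
    apply/existsP; exists k.
  by rewrite kC /=.
exists (room_at s C m i), (room_at s C m j); split.
  case: room_atP => [x xa xmax|a0]; case: room_atP => [y ya ymax|b0].
  - have xs := above_notin mi xa.
    apply/negP => /eqP[] e; move: (setU11 x s); rewrite e => /setU1P[xy|];
      last by apply/negP.
    by have /negP[] := above2 m_in ij dom xa; rewrite xy.
  - have xs := above_notin mi xa.
    by apply/negP => /eqP[] e _; move: (setU11 x s); rewrite e; apply/negP.
  - have ys := above_notin mj ya.
    by apply/negP => /eqP[] e _; move: (setU11 y s); rewrite -e; apply/negP.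
  - apply/negP => /eqP[] /setP/(_ i); by rewrite !inE eqxx ij iC.
move=> q; apply/idP/idP => [/orP[]/eqP->|]; [exact: room|exact: room|].
case/andP => domq /orP[/existsP[x /andP[xs /eqP qE]]|/existsP[k /andP[kC /eqP qE]]].
  move: domq; rewrite {}qE /= => domq.
  have [k kC [xa mk]] := dominant_setU1_above m_in m_min cardC xs domq.
  have xmax := above_max m_in kC xa domq.
  have -> : (x |: s, C) = room_at s C m k.
    case: room_atP => [y ya ymax|a0]; last by move: xa; rewrite a0 inE.
    congr (_ |: _, _); apply: (@r_inj k); apply/eqP.
    by rewrite eqn_leq xmax ?ymax.
  by case/orP: (pair k kC mk) => /eqP->; rewrite eqxx ?orbT.
move: domq; rewrite {}qE /= => domq.
have mk := dominant_argmin m_in m_min domq.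
have -> : (s, C :\ k) = room_at s C m k.
  case: room_atP => [y ya ymax|//].
  by move: domq ya; rewrite (dominant_above0 C m_in m_min) => /eqP->; rewrite inE.
by case/orP: (pair k kC mk) => /eqP->; rewrite eqxx ?orbT.
Qed.

(** * Rooms, doors and their incidence *)

Definition room (q : {set T} * {set I}) := dominant q.1 q.2 && (#|q.1| == #|q.2|).

(** These are the almost completely labelled walls of a Sperner-type parity argument: by cardinality
    the labels on [d.1] are distinct and miss only [i0]. *)
Definition door (d : {set T} * {set I}) :=
  [&& dominant d.1 d.2, i0 \in d.2, #|d.2| == #|d.1|.+1 & c @: d.1 == d.2 :\ i0].

Definition adj (d q : {set T} * {set I}) :=
  [exists x, (x \notin d.1) && (q == (x |: d.1, d.2))]
  || [exists i, (i \in d.2) && (q == (d.1, d.2 :\ i))].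

Lemma adj_room d q : door d -> adj d q -> (#|q.1| == #|q.2|).
Proof.
case/and4P => _ _ /eqP cd _.
case/orP => [/existsP[x /andP[xd /eqP->]]|/existsP[i /andP[iC /eqP->]]] /=.
  by rewrite cardsU1 xd cd.
by have := cardsD1 i d.2; rewrite iC cd add1n => -[->].
Qed.

Lemma door_degree d : door d -> d.1 != set0 -> #|[set q | room q && adj d q]| = 2.
Proof.
move=> dd d0; case: (and4P dd) => dom _ /eqP cd _.
have [a [b [ab H]]] := rooms_of_door d0 dom cd.
rewrite (_ : [set q | _] = [set a; b]) ?cards2 ?ab//.
apply/setP => q; rewrite !inE H /room; apply/idP/idP => [/andP[/andP[-> _]]//|].
by case/andP => -> h; rewrite (@adj_room d).
Qed.

Lemma door0 C : door (set0, C) = (C == [set i0]).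
Proof.
rewrite /door /= imset0 cards0; apply/and4P/eqP => [[_ iC /eqP c1 /eqP e]|->].
  apply/setP => i; rewrite inE; have [->|ii] := eqVneq i i0; first by [].
  by apply/negP => iC'; have := in_set0 i; rewrite e !inE ii iC'.
split; rewrite ?set11 ?cards1 ?setDv//.
by apply/dominantP => y; exists i0; rewrite ?set11// => x; rewrite inE.
Qed.

(** Dropping [i0] leaves no index to dominate with, and a singleton is dominant for [i0] only at the
    unique [r i0]-maximum of [T]. *)
Lemma door0_degree : #|[set q | room q && adj (set0, [set i0]) q]| = 1.
Proof.
have [z _ zmax] := arg_maxnP (r i0) (erefl : xpredT x0).
rewrite (_ : [set q | _] = [set ([set z], [set i0])]) ?cards1//.
apply/setP => q; rewrite !inE; apply/andP/eqP => [[/andP[domq _]]|->].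
  case/orP => [/existsP[x /andP[_ /eqP qE]]|/existsP[i /andP[iC /eqP qE]]].
    move: domq; rewrite qE /= setU0 =>
      /dominantP/(_ z)[i /set1P-> /(_ _ (set11 x))] zx.
    congr ([set _], _); apply: (@r_inj i0); apply/eqP.
    by rewrite eqn_leq zx andbT; exact: zmax.
  move: domq; rewrite qE => /dominantP/(_ x0)[j /= + _].
  by move: iC; rewrite /= => /set1P ->; rewrite setDv inE.
split; last by apply/orP; left; apply/existsP; exists z; rewrite inE setU0 eqxx.
rewrite /room /= !cards1 eqxx andbT; apply/dominantP => y.
by exists i0 => [|x /set1P->]; [exact: set11|exact: zmax].
Qed.

Lemma adjP d s (D : {set I}) :
  reflect ((exists2 y, y \in s & d = (s :\ y, D))
           \/ exists2 i, i \notin D & d = (s, i |: D)) (adj d (s, D)).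
Proof.
case: d => t E; apply: (iffP orP) => /=.
  case=> [/existsP[x /andP[xt /eqP[-> ->]]]|/existsP[i /andP[iE /eqP[-> ->]]]].
    by left; exists x; rewrite ?setU11// setU1K.
  by right; exists i; rewrite ?setD1K// !inE eqxx.
case=> -[x xs [-> ->]]; [left|right]; apply/existsP; exists x.
  by rewrite setD1K// !inE !eqxx.
by rewrite setU1K// setU11 eqxx.
Qed.

(** * The doors of a room *)

Section RoomDegree.
Variables (s : {set T}) (D : {set I}).
Hypotheses (doms : dominant s D) (cards : #|s| = #|D|).

Lemma door_inj t E : door (t, E) -> {in t &, injective c}.
Proof.
case/and4P => /= _ iE /eqP cE /eqP ct; apply/imset_injP; rewrite ct.
by have := cardsD1 i0 E; rewrite iE cE add1n => -[->].
Qed.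

Lemma doorD1 x : i0 \in D -> x \in s ->
  door (s :\ x, D) = (c @: (s :\ x) == D :\ i0).
Proof.
move=> iD xs; rewrite /door /= iD /= -cards (cardsD1 x s) xs eqxx /=.
by rewrite (dominant_mono _ _ doms)// subD1set.
Qed.

Lemma doorU1 i : i0 \in D -> i \notin D ->
  door (s, i |: D) = (c @: s == (i |: D) :\ i0).
Proof.
move=> iD iND; rewrite /door /= inE iD orbT /= cardsU1 iND cards eqxx /=.
by rewrite (dominant_mono _ _ doms)// subsetU1.
Qed.

(** Labels on a door are distinct, so one of the two twins has to be removed; adding an index would
    keep both. *)
Lemma room_degree_twin x x' : i0 \in D -> x \in s -> x' \in s -> x != x' ->
  c x = c x' -> c @: (s :\ x) = D :\ i0 ->
  [set d | door d && adj d (s, D)] = [set (s :\ x, D); (s :\ x', D)].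
Proof.
move=> iD xs xs' xx cxx cD; apply/setP => d; rewrite !inE.
have cD' : c @: (s :\ x') = D :\ i0.
  rewrite -cD; apply/eqP; rewrite eqEsubset; apply/andP.
  split; apply/subsetP => _ /imsetP[y /setD1P[yx ys] ->].
    have [->|yx'] := eqVneq y x; first by rewrite cxx imset_f// !inE eq_sym xx.
    by rewrite imset_f// !inE yx'.
  have [->|yx'] := eqVneq y x'; first by rewrite -cxx imset_f// !inE xx.
  by rewrite imset_f// !inE yx'.
apply/andP/orP => [[dd /adjP[]]|[]/eqP->]; last 2 first.
- by rewrite doorD1// cD; split => //; apply/adjP; left; exists x.
- by rewrite doorD1// cD'; split => //; apply/adjP; left; exists x'.
- case=> y ys dE; move: dd; rewrite dE => /door_inj inj.
  have : (y == x) || (y == x').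
    apply: contraNT xx; rewrite negb_or ![y == _]eq_sym => /andP[yx yx'].
    by apply/eqP/inj; rewrite // !inE ?yx ?yx'.
  by case/orP => /eqP->; rewrite eqxx; [left|right].
- case=> i _ dE; move: dd; rewrite dE => /door_inj inj.
  by case/eqP: xx; apply: inj.
Qed.

(** The label [c x] is foreign to [D]: a door must either lose [x] or gain the index [c x]. *)
Lemma room_degree_new x : i0 \in D -> x \in s -> c x \notin D ->
  c @: (s :\ x) = D :\ i0 ->
  [set d | door d && adj d (s, D)] = [set (s :\ x, D); (s, c x |: D)].
Proof.
move=> iD xs cxD cD; apply/setP => d; rewrite !inE.
have cs : c @: s = (c x |: D) :\ i0.
  rewrite -(setD1K xs) imsetU1 cD; apply/setP => k; rewrite !inE.
  by have [->|//] := eqVneq k (c x); rewrite andbT; apply/esym;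
    apply: contraNneq cxD => ->.
apply/andP/orP => [[dd /adjP[]]|[]/eqP->]; last 2 first.
- by rewrite doorD1// cD; split => //; apply/adjP; left; exists x.
- by rewrite doorU1// cs; split => //; apply/adjP; right; exists (c x).
- case=> y ys dE; move: dd; rewrite dE doorD1// => /eqP cy.
  have [->|yx] := eqVneq y x; first by left.
  have : c x \in D :\ i0 by rewrite -cy imset_f// !inE eq_sym yx.
  by rewrite inE (negbTE cxD) andbF.
- case=> i iD' dE; move: dd; rewrite dE doorU1// => /eqP ci.
  have : c x \in (i |: D) :\ i0 by rewrite -ci imset_f.
  by rewrite !inE (negbTE cxD) orbF => /andP[_ /eqP->]; right.
Qed.

(** If the door adds an index [i], then [i] differs from [i0], as otherwise the labels of [s] would
    be exactly [D]. The point labelled [i] is then the one to remove. *)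
Lemma adjacent_door d : c @: s != D -> door d -> adj d (s, D) ->
  i0 \in D /\ exists2 x, x \in s & c @: (s :\ x) = D :\ i0.
Proof.
move=> csD dd; case/adjP => [[y ys dE]|[i iD dE]]; move: dd; rewrite dE.
  by case/and4P => _ /= iD _ /eqP cD; split=> //; exists y.
move=> dd; have inj := door_inj dd; case/and4P: dd => _ /= i0D _ /eqP cE.
have ii : i0 != i.
  by apply: contraNneq csD => ie; rewrite cE ie setU1K.
have i0D' : i0 \in D by move: i0D; rewrite !inE (negbTE ii).
split=> //; have /imsetP[x xs ix] : i \in c @: s by rewrite cE !inE eq_sym ii eqxx.
exists x => //; apply/setP => k;
  apply/imsetP/setD1P => [[y /setD1P[yx ys] ->]|[ki kD]].
  have : c y \in (i |: D) :\ i0 by rewrite -cE imset_f.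
  rewrite !inE => /andP[-> /orP[/eqP|//]]; rewrite ix => /inj cc.
  by move: yx; rewrite cc ?eqxx.
have : k \in c @: s by rewrite cE !inE ki kD orbT.
case/imsetP => y ys ky; exists y => //; rewrite !inE ys andbT.
by apply: contraNneq iD => yx; rewrite ix -yx -ky.
Qed.

End RoomDegree.

(** Once there is a door, [adjacent_door] gives a point [x] to remove. Its label is not [i0], so it
    is either repeated in [s] or outside [D], and both cases give two doors. *)
Lemma room_degree q : room q -> c @: q.1 != q.2 ->
  ~~ odd #|[set d | door d && adj d q]|.
Proof.
case: q => s D /andP[/= doms /eqP cards] csD.
have [->|/set0Pn[d]] := eqVneq [set d | door d && adj d (s, D)] set0; first
  by rewrite cards0.
rewrite inE => /andP[dd da].
have [iD [x xs cD]] := adjacent_door csD dd da.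
have [cxD|cxD] := boolP (c x \in D).
  have ci : c x != i0.
    apply: contraNneq csD => ci.
    by rewrite -(setD1K xs) imsetU1 cD ci setD1K.
  have : c x \in c @: (s :\ x) by rewrite cD !inE ci.
  case/imsetP => x' /setD1P[xx xs'] cxx.
  rewrite (room_degree_twin doms cards iD xs xs' _ cxx cD) 1?eq_sym//.
  rewrite cards2; case: eqP => // -[] /setP/(_ x').
  by rewrite !inE eqxx xx xs'.
rewrite (room_degree_new doms cards iD xs cxD cD) cards2;
  case: eqP => // -[] /setP/(_ x).
by rewrite !inE eqxx xs.
Qed.

Lemma even_sum (J : finType) (P : pred J) (F : J -> nat) :
  (forall j, P j -> ~~ odd (F j)) -> ~~ odd (\sum_(j | P j) F j).
Proof.
move=> H; apply: (big_ind (fun n => ~~ odd n)) => // m n.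
by rewrite oddD => /negbTE-> /negbTE->.
Qed.

(* Each door has two rooms except the outer door [(set0, [set i0])], which has
   one; each room whose labels are not its own index set has zero or two doors.
   So counting incidences modulo 2 leaves a room labelled by its index set. *)
Theorem scarf : exists q : {set T} * {set I},
  [/\ dominant q.1 q.2, #|q.1| = #|q.2| & c @: q.1 = q.2].
Proof.
have [/existsP[q /andP[/andP[dq /eqP qq] /eqP cq]]|no] :=
  boolP [exists q, room q && (c @: q.1 == q.2)]; first by exists q.
have : \sum_(d | door d) #|[set q | room q && adj d q]|
     = \sum_(q | room q) #|[set d | door d && adj d q]|.
  under eq_bigr do rewrite -sum1dep_card big_mkcondr /=.
  under [RHS]eq_bigr do rewrite -sum1dep_card big_mkcondr /=.
  exact: exchange_big.
move/(congr1 odd); rewrite (bigD1 (set0, [set i0])) ?door0//= door0_degree oddD.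
rewrite !(negbTE (even_sum _))//.
- move=> q rq; apply: room_degree => //.
  by apply: contraNneq no => cq; apply/existsP; exists q; rewrite rq cq eqxx.
- move=> [t E] /andP[dd]; have [t0|t0 _] := eqVneq t set0.
    by move: dd; rewrite t0 door0 => /eqP->; rewrite eqxx.
  by rewrite door_degree.
Qed.
End Scarf.

(** * Scarf's lemma with ties and on lattice points *)

Lemma scarf_ties (T I : finType) (r : I -> T -> nat) (c : T -> I) (x0 : T)
    (i0 : I) :
  exists q : {set T} * {set I},
    [/\ dominant r q.1 q.2, #|q.1| = #|q.2| & c @: q.1 = q.2].
Proof.
(* Ties are broken lexicographically by [enum_rank]; comparisons in [r'] imply the weak comparisons
   in [r] that dominance asks for. *)
pose r' i x := r i x * #|T| + enum_rank x.
have r'_inj i : injective (r' i).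
  move=> x y /(congr1 (modn^~ #|T|)); rewrite /r' !modnMDl !modn_small ?ltn_ord//.
  by move/val_inj/enum_rank_inj.
have r'_le i x y : r' i x <= r' i y -> r i x <= r i y.
  move=> h; rewrite leqNgt; apply/negP => lt.
  have : (r i y).+1 * #|T| <= r i x * #|T| by rewrite leq_mul2r lt orbT.
  rewrite mulSn; apply/negP; rewrite -ltnNge.
  by apply: leq_ltn_trans (leq_trans (leq_addr _ _) h) _;
    rewrite [ltnRHS]addnC ltn_add2l ltn_ord.
have [q [/dominantP dq cq eq]] := @scarf _ _ r' c x0 i0 r'_inj.
exists q; split=> //; apply/dominantP => y.
by have [i iC h] := dq y; exists i => // x /h/r'_le.
Qed.

(** Scarf's lemma is applied with the coordinates as orders. Dominance leaves a slack below [#|I|]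
    between [m] and the sum over [D] of the coordinate minima of [s]. Hence [s] is a small cluster,
    its coordinates outside [D] are small, and each index of [D] labels one of its points. *)
Lemma lattice_scarf (I : finType) (i0 : I) (m : nat) (c : (I -> nat) -> I) :
  exists2 x : I -> nat, \sum_i x i = m &
    forall i, x i <= #|I| \/
      exists w : I -> nat, [/\ \sum_i w i = m, c w = i,
        forall j, x j <= w j + #|I| & forall j, w j <= x j + #|I|].
Proof.
pose T := {x : {ffun I -> 'I_m.+1} | \sum_i x i == m}.
pose v (x : T) i : nat := val x i.
have v_sum x : \sum_i v x i = m by apply/eqP; apply: (valP x).
have T_of (g : I -> nat) : \sum_i g i = m -> exists x : T, forall i, v x i = g i.
  move=> gm; have gle i : g i < m.+1.
    by rewrite ltnS -gm (bigD1 i)//= leq_addr.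
  pose x : {ffun I -> 'I_m.+1} := [ffun i => Ordinal (gle i)].
  have xm : \sum_i x i == m by rewrite -[in X in _ == X]gm;
    apply/eqP/eq_bigr => i _; rewrite ffunE.
  by exists (Sub x xm : T) => i; rewrite /v SubK ffunE.
have [x0 _] : exists x : T, forall i, v x i = (if i == i0 then m else 0).
  by apply: T_of; rewrite -big_mkcond /= big_pred1_eq.
have [[s D] /= [/dominantP dom cardsD cD]] :=
  scarf_ties (fun i x => v x i) (fun x => c (v x)) x0 i0.
have s0 : s != set0.
  apply/eqP => s0; have [i + _] := dom x0; rewrite -cD s0 imset0 inE //.
have [d0 d0D _] := dom x0.
have /fin_all_exists[y yP] : forall i, exists y,
    y \in s /\ forall z, z \in s -> v y i <= v z i.
  by move=> i; have [y ys h] := @argmin_ex _ _ (fun i x => v x i) s i s0; exists y.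
pose mu i := v (y i) i.
have mule i z : z \in s -> mu i <= v z i by case: (yP i) => _; apply.
(* Otherwise some lattice point would exceed [mu] in all coordinates of [D],
   against dominance. *)
have lbD : m < \sum_(i in D) (mu i).+1.
  rewrite ltnNge; apply/negP => h.
  (* Every coordinate in [D] gets one more than its minimum, and [d0] absorbs what remains of
     [m]. *)
  pose g i := if i \in D then
    if i == d0 then m - \sum_(i in D | i != d0) (mu i).+1 else (mu i).+1 else 0.
  have gm : \sum_i g i = m.
    rewrite -big_mkcond /= (bigD1 d0)//= eqxx.
    under [X in _ + X]eq_bigr => i /andP[_ /negbTE ->] do [].
    by rewrite subnK// (leq_trans _ h)// [leqRHS](bigD1 d0)//= leq_addl.
  have [x xg] := T_of _ gm; have [i iD hi] := dom x.
  have [yi _] := yP i.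
  have := hi _ yi; rewrite -/(mu i) xg /g iD; case: eqP => [ie|_]; last
    by rewrite ltnn.
  by move: h; rewrite (bigD1 d0)//= -ie; lia.
have card : #|D| <= #|I| by apply: max_card.
have sumD z : \sum_(i in D) v z i + \sum_(i | i \notin D) v z i = m
  by rewrite -(v_sum z) [RHS](bigID (mem D)).
have muS : m < \sum_(i in D) mu i + #|I|.
  move: lbD; under eq_bigr do rewrite -addn1; rewrite big_split /= sum1_card => h.
  by apply: leq_trans h _; rewrite leq_add2l.
(* Coordinates of [z] in [D] are at least their minima, which already sum to more than [m - #|I|];
   no single coordinate can take more than the slack. *)
have ub z i : z \in s ->
    (i \in D -> v z i <= mu i + #|I|) /\ (i \notin D -> v z i <= #|I|).
  move=> zs; split=> iD; move: muS; rewrite -{1}(sumD z).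
    rewrite (bigD1 i)//= [in X in _ < X](bigD1 i)//=.
    have : \sum_(j in D | j != i) mu j <= \sum_(j in D | j != i) v z j.
      by apply: leq_sum => j _; apply: mule.
    by lia.
  rewrite [X in _ + X](bigD1 i)//=.
  have : \sum_(j in D) mu j <= \sum_(j in D) v z j.
    by apply: leq_sum => j _; apply: mule.
  by lia.
have close z z' i : z \in s -> z' \in s -> v z i <= v z' i + #|I|.
  move=> zs zs'; have [ub1 ub2] := ub z i zs; have := mule i _ zs'.
  have [/ub1|/ub2] := boolP (i \in D); lia.
have [x xs] := set0Pn _ s0.
exists (v x) => // i; have [iD|iD] := boolP (i \in D); last by left;
  apply: (ub _ _ xs).2.
right; move: (iD); rewrite -cD => /imsetP[w ws ->].
by exists (v w); split=> // j; apply: close.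
Qed.

(** * Symmetric equilibria *)

From mathcomp Require Import all_classical all_reals all_analysis.
Import Order.TTheory GRing.Theory Num.Theory.
Import numFieldNormedType.Exports.
Local Open Scope classical_set_scope.
Local Open Scope ring_scope.

(** Label each lattice point by an index of largest payoff. If coordinate [i] of the point found by
    [lattice_scarf] is not small, then [i] is a best reply to a nearby point, hence nearly one to
    the point itself. *)
Lemma approximate_equilibrium (R : realType) (q : nat)
    (B : 'I_q.+1 -> 'I_q.+1 -> R) :
  exists2 K : R, 0 <= K & forall m : nat, exists z : 'I_q.+1 -> R,
    [/\ forall i, 0 <= z i, \sum_i z i = 1 &
      forall i, z i <= K / m.+1%:R \/
        forall j, \sum_k B j k * z k <= \sum_k B i k * z k + K / m.+1%:R].
Proof.
pose N : R := q.+1%:R; pose S := \sum_i \sum_j `|B i j|.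
have S0 : 0 <= S by apply: sumr_ge0 => i _; apply: sumr_ge0.
have N0 : 0 <= N by [].
(* The term [N] bounds a small coordinate; [2 * (N * S)] accounts for two payoffs, each changing by
   at most [N * S] between neighbouring points. *)
exists (N + 2 * (N * S)) => [|m]; first by rewrite addr_ge0 ?mulr_ge0.
pose F (x : 'I_q.+1 -> nat) i : R := \sum_k B i k * (x k)%:R.
have /choice[c cP] : forall x, exists i, forall j, F x j <= F x i.
  move=> x; have [i _ h] := Order.TotalTheory.arg_maxP (F x) (erefl : xpredT ord0).
  by exists i => j; apply: h.
have [x xm xP] := lattice_scarf ord0 m.+1 c.
have M0 : 0 < m.+1%:R :> R by [].
have Fz w j : \sum_k B j k * ((w k)%:R / m.+1%:R) = F w j / m.+1%:R.
  by rewrite /F mulr_suml; apply: eq_bigr => k _; rewrite mulrA.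
exists (fun i => (x i)%:R / m.+1%:R); split.
- by move=> i; rewrite divr_ge0.
- by rewrite -mulr_suml -natr_sum xm divff ?gt_eqF.
move=> i; have [xi|[w [wm cw xw wx]]] := xP i; [left|right].
  rewrite ler_pM2r ?invr_gt0// (@le_trans _ _ N)//.
    by rewrite ler_nat -[q.+1]card_ord.
  by rewrite lerDl !mulr_ge0.
move=> j; rewrite !Fz -mulrDl ler_pM2r ?invr_gt0//.
have close k : `|(x k)%:R - (w k)%:R| <= N.
  by rewrite ler_distl lerBlDr -!natrD !ler_nat -[q.+1]card_ord xw wx.
have diff l : `|F x l - F w l| <= N * S.
  rewrite /F -sumrB (le_trans (ler_norm_sum _ _ _))//.
  have Sl : \sum_k `|B l k| <= S.
    rewrite /S [leRHS](bigD1 l)//= lerDl sumr_ge0// => a _; exact: sumr_ge0.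
  apply: le_trans (ler_wpM2l N0 Sl); rewrite mulr_sumr; apply: ler_sum => k _.
  by rewrite -mulrBr normrM mulrC ler_wpM2r.
have := cP w j; rewrite cw; have := diff i; have := diff j.
rewrite !ler_norml => /andP[_ h1] /andP[h2 _] h3.
by lra.
Qed.

(** * Continuity, compactness and passage to an exact equilibrium *)

Lemma continuous_sum (R : realType) (T : topologicalType) (I : Type) (r : seq I)
    (F : I -> T -> R) :
  (forall i, continuous (F i)) -> continuous (fun x => \sum_(i <- r) F i x).
Proof.
by move=> cF; apply: continuous_big => //; exact: add_continuous.
Qed.

Lemma continuous_mul (R : realType) (T : topologicalType) (f g : T -> R) :
  continuous f -> continuous g -> continuous (fun x => f x * g x).
Proof. by move=> cf cg x; exact: cvgM (cf x) (cg x). Qed.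

Lemma continuous_sub (R : realType) (T : topologicalType) (f g : T -> R) :
  continuous f -> continuous g -> continuous (fun x => f x - g x).
Proof. by move=> cf cg x; exact: cvgB (cf x) (cg x). Qed.

Lemma closed_fun_eq (R : realType) (T : topologicalType) (f : T -> R) (a : R) :
  continuous f -> closed [set x | f x = a].
Proof.
by move=> cf; apply: (preimage_closed (D := [set y | y = a])) => [x _|];
  [exact: cf|exact: closed_eq].
Qed.

Lemma compact_min (R : realType) (T : topologicalType) (f : T -> R) (A : set T) :
  A !=set0 -> compact A -> continuous f ->
  exists2 a, A a & forall x, A x -> f a <= f x.
Proof.
move=> A0 cA cf; have [a] := compact_EVT_min A0 cA (continuous_subspaceT cf).
by rewrite inE => Aa h; exists a => // x Ax; apply: h; rewrite inE.
Qed.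

Definition simplex (R : realType) (q : nat) : set 'rV[R]_q :=
  [set z | (forall i, 0 <= z ord0 i) /\ \sum_i z ord0 i = 1].

Lemma simplex_le1 (R : realType) (q : nat) (z : 'I_q -> R) i :
  (forall i, 0 <= z i) -> \sum_i z i = 1 -> z i <= 1.
Proof.
by move=> z0 <-; rewrite (bigD1 i)//= lerDl sumr_ge0.
Qed.

Lemma simplex_compact (R : realType) (q : nat) : compact (@simplex R q).
Proof.
have -> : @simplex R q = [set z | forall i, `[0, 1]%classic (z ord0 i)]
                      `&` [set z | \sum_i z ord0 i = 1].
  apply/seteqP; split=> z [z0 z1]; split=> // i.
    by rewrite /= in_itv /= z0 simplex_le1.
  by have /andP[] := z0 i.
apply: compact_closedI; first
  by apply: (@rV_compact _ _ (fun=> `[(0:R), 1]%classic)) => _;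
  exact: segment_compact.
by apply: closed_fun_eq;
  apply: (@continuous_sum R _ _ _ (fun i (z : 'rV[R]_q) => z ord0 i)) => i;
  exact: coord_continuous.
Qed.

(** The defect [g i j] is continuous and nonnegative on the simplex, and it vanishes exactly when
    [z i] is zero or [j] pays no more than [i]. The minimum of the total defect is attained and lies
    below [C / m.+1%:R] for every [m], so it is zero. *)
Theorem symmetric_equilibrium (R : realType) (q : nat)
    (B : 'I_q.+1 -> 'I_q.+1 -> R) :
  exists z : 'I_q.+1 -> R,
    [/\ forall i, 0 <= z i, \sum_i z i = 1 &
      forall i j, 0 < z i -> \sum_k B j k * z k <= \sum_k B i k * z k].
Proof.
pose BB (z : 'rV[R]_q.+1) i := \sum_k B i k * z ord0 k.
pose g i j (z : 'rV[R]_q.+1) := Num.min (z ord0 i) (Num.max 0 (BB z j - BB z i)).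
have cB i : continuous (BB ^~ i).
  apply: (@continuous_sum R _ _ _
    (fun k (z : 'rV[R]_q.+1) => B i k * z ord0 k)) => k.
  apply: (@continuous_mul R _ (fun=> B i k)); first exact: cst_continuous.
  exact: coord_continuous.
have cg i j : continuous (g i j).
  move=> z; apply: (@continuous_min _ _ (fun z : 'rV_ _ => z ord0 i));
    first exact: coord_continuous.
  apply: (@continuous_max _ _ (fun=> 0)); first exact: cst_continuous.
  by apply: (@continuous_sub R _ (BB ^~ j) (BB ^~ i)).
have g0 i j z : simplex z -> 0 <= g i j z.
  by case=> z0 _; rewrite /g le_min z0 le_max lexx.
have [z sz zmin] : exists2 z, simplex z &
    forall x, simplex x -> \sum_i \sum_j g i j z <= \sum_i \sum_j g i j x.
  apply: compact_min (@simplex_compact R q.+1) _; last first.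
    apply: (@continuous_sum R _ _ _ (fun i z => \sum_j g i j z)) => i.
    by apply: (@continuous_sum R _ _ _ (g i)) => j; apply: cg.
  exists (\row_j (j == ord0)%:R); split; first by move=> i; rewrite mxE.
  under eq_bigr do rewrite mxE.
  by rewrite (bigD1 ord0)//= big1 ?addr0// => i /negbTE->.
have [K K0 HK] := approximate_equilibrium B.
pose C := K * (q.+1 * q.+1)%:R.
have small (m : nat) : \sum_i \sum_j g i j z <= C / m.+1%:R.
  have [x [x0 x1 xP]] := HK m.
  have sx : simplex (\row_j x j).
    by split=> [i|]; rewrite ?mxE//; under eq_bigr do rewrite mxE.
  apply: le_trans (zmin _ sx) _.
  have -> : C / m.+1%:R = \sum_(i < q.+1) \sum_(j < q.+1) K / m.+1%:R.
    by rewrite !sumr_const !card_ord -mulrnA -[RHS]mulr_natr /C mulrAC.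
  apply: ler_sum => i _; apply: ler_sum => j _.
  have BBE l : BB (\row_j x j) l = \sum_k B l k * x k.
    by apply: eq_bigr => k _; rewrite mxE.
  rewrite /g !BBE mxE ge_min ge_max; have [->//|/(_ j) h] := xP i.
  by rewrite divr_ge0//= lerBlDl h orbT.
have sum0 : \sum_i \sum_j g i j z = 0.
  apply/eqP; rewrite eq_le; apply/andP; split; last first.
    by apply: sumr_ge0 => i _; apply: sumr_ge0 => j _; apply: g0.
  rewrite leNgt; apply/negP => S0; set S := (X in 0 < X) in S0 small.
  have C0 : 0 <= C / S by rewrite divr_ge0 ?mulr_ge0// ltW.
  have : (Num.Def.archi_bound (C / S)).+1%:R <= C / S.
    by rewrite ler_pdivlMr// mulrC -ler_pdivlMr//; exact: small.
  by rewrite leNgt (lt_trans (archi_boundP C0))// ltr_nat.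
have gz i j : g i j z = 0.
  move/eqP: sum0; rewrite psumr_eq0; last first.
    by move=> a _; apply: sumr_ge0 => b _; apply: g0.
  move=> /allP/(_ i (mem_index_enum _)); rewrite psumr_eq0; last by move=> b _;
    apply: g0.
  by move=> /allP/(_ j (mem_index_enum _)) /eqP.
exists (z ord0); split; [exact: sz.1|exact: sz.2|] => i j zi.
have := gz i j; rewrite /g; case: (ltP _ (Num.max _ _)) => [_ zi0|_]; first
  by move: zi; rewrite zi0 ltxx.
by move=> e; rewrite -subr_le0 -[leRHS]e le_max lexx orbT.
Qed.

(** * The point of least norm of a join *)

Section Dot.
Variables (R : realType) (n : nat).
Implicit Types u v : 'rV[R]_n.

Definition dotv u v : R := \sum_c u ord0 c * v ord0 c.

Lemma dotvC u v : dotv u v = dotv v u.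
Proof. by apply: eq_bigr => c _; rewrite mulrC. Qed.

Lemma dotvDl u1 u2 v : dotv (u1 + u2) v = dotv u1 v + dotv u2 v.
Proof. by rewrite -big_split; apply: eq_bigr => c _; rewrite mxE mulrDl. Qed.

Lemma dotvZl a u v : dotv (a *: u) v = a * dotv u v.
Proof. by rewrite mulr_sumr; apply: eq_bigr => c _; rewrite mxE mulrA. Qed.

Lemma dotv_suml (I : finType) (F : I -> 'rV[R]_n) v :
  dotv (\sum_i F i) v = \sum_i dotv (F i) v.
Proof.
rewrite /dotv exchange_big /=; apply: eq_bigr => c _.
by rewrite summxE mulr_suml.
Qed.

Lemma dotvv_ge0 u : 0 <= dotv u u.
Proof. by apply: sumr_ge0 => c _; rewrite -expr2 sqr_ge0. Qed.

Lemma dotvv_gt0 u : u != 0 -> 0 < dotv u u.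
Proof.
move=> u0; rewrite lt_def dotvv_ge0 andbT; apply: contraNneq u0 => /eqP.
rewrite psumr_eq0; last by move=> c _; rewrite -expr2 sqr_ge0.
move=> /allP h; apply/eqP/rowP => c; rewrite mxE.
by have := h c (mem_index_enum _); rewrite mulf_eq0 orbb => /eqP.
Qed.
End Dot.

Lemma weight_gt0_ex (R : realType) (q : nat) (t : 'I_q -> R) :
  \sum_i t i = 1 -> exists i, 0 < t i.
Proof.
move=> t1; apply: contrapT => no; suff : \sum_i t i <= 0 by rewrite t1 ler10.
by apply: sumr_le0 => i _; rewrite leNgt; apply/negP => ti; apply: no; exists i.
Qed.

(** A convex combination of positive numbers [dotv (x i) p] could not be [dotv 0 p]. *)
Lemma conv_hull_halfspace (R : realType) (n : nat) (X : set 'rV[R]_n) (p : 'rV[R]_n) :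
  conv_hull X 0 -> exists2 y, X y & dotv y p <= 0.
Proof.
move=> [m [t [x [t0 t1 xX zE]]]].
apply: contrapT => no.
have xp i : 0 < dotv (x i) p.
  by rewrite ltNge; apply/negP => h; apply: no; exists (x i).
have [i ti] := weight_gt0_ex t1.
have : 0 < \sum_i dotv (t i *: x i) p.
  rewrite (bigD1 i)//= ltr_pwDl ?dotvZl ?mulr_gt0// sumr_ge0// => j _.
  by rewrite dotvZl mulr_ge0// ltW.
rewrite -dotv_suml -zE -(scale0r (0 : 'rV[R]_n)) dotvZl mul0r ltxx //.
Qed.

Lemma convexS_conv_hull (R : realType) (n : nat) (S : set 'rV[R]_n) :
  convexS S -> conv_hull S `<=` S.
Proof.
move=> cS _ [m [t [x [t0 t1 xS ->]]]].
elim: m => [|m IH] in t x t0 t1 xS *.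
  by move: t1; rewrite big_ord0 => /eqP; rewrite eq_sym oner_eq0.
rewrite big_ord_recl; move: t1; rewrite big_ord_recl => t1.
set a := t ord0 in t1 *; set s := \sum_(i < m) _ in t1.
have s0 : 0 <= s by apply: sumr_ge0.
have [sE|sN] := eqVneq s 0.
  rewrite big1 => [|i _]; first by move: t1; rewrite sE !addr0 => ->;
    rewrite scale1r.
  move/eqP: sE; rewrite psumr_eq0// => /allP/(_ i (mem_index_enum _))/eqP->.
  by rewrite scale0r.
have -> : \sum_(i < m) t (lift ord0 i) *: x (lift ord0 i)
    = (1 - a) *: \sum_(i < m) (t (lift ord0 i) / s) *: x (lift ord0 i).
  rewrite scaler_sumr; apply: eq_bigr => i _; rewrite scalerA; congr (_ *: _).
  by rewrite -t1 addrAC subrr add0r mulrC divfK.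
apply: cS; [exact: xS| |exact: t0|by rewrite -t1 lerDl].
apply: IH => [i||i]; [exact: divr_ge0| |exact: xS].
by rewrite -mulr_suml divff.
Qed.

(** The join is parametrised by families of pairs (weight, point). These form a closed part of a
    product of the compact sets [[0, 1]] times [X i], and the norm is minimised over the
    parameters. *)
Lemma join_min (R : realType) (n q : nat) (X : 'I_q -> set 'rV[R]_n) :
  (forall i, compact (X i)) -> join X !=set0 ->
  exists2 p, join X p & forall z, join X z -> dotv p p <= dotv z z.
Proof.
move=> cX [z0 z0X].
pose V : 'I_q -> topologicalType := fun=> (R * 'rV[R]_n)%type.
pose T := prod_topology V.
pose A := [set f : T | forall i, (`[0, 1] `*` X i) (f i)]
          `&` [set f : T | \sum_i (f i).1 = 1].
have cf1 i : continuous (fun f : T => (f i).1).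
  by move=> f; apply: (@continuous_comp _ _ _ (fun f : T => f i) fst);
    [exact: (@proj_continuous _ V i)|exact: cvg_fst].
have cf2 i c : continuous (fun f : T => (f i).2 ord0 c).
  move=> f; apply: (@continuous_comp _ _ _ (fun f : T => f i)
    (fun v : R * 'rV[R]_n => v.2 ord0 c)).
    exact: (@proj_continuous _ V i).
  apply: (@continuous_comp _ _ _ snd (fun v : 'rV[R]_n => v ord0 c));
    first exact: cvg_snd.
  exact: coord_continuous.
have cA : compact A.
  apply: compact_closedI;
    last exact/closed_fun_eq/(@continuous_sum R _ _ _ (fun i (f : T) => (f i).1)).
  by apply: (@tychonoff _ V (fun i => `[0, 1] `*` X i)) => i;
    apply: compact_setX => //; exact: segment_compact.
pose g (f : T) := \sum_i (f i).1 *: (f i).2.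
have Ag z : join X z -> exists2 f, A f & z = g f.
  move=> [t [x [t_ge0 t1 xX ->]]]; exists (fun i => (t i, x i)) => //.
  by split=> // i; split=> //=; rewrite in_itv /= t_ge0 simplex_le1.
have gA f : A f -> join X (g f).
  move=> [fX f1]; exists (fun i => (f i).1), (fun i => (f i).2); split => // i.
    by have [/=] := fX i; rewrite in_itv => /andP[].
  by have [] := fX i.
have cg c : continuous (fun f => g f ord0 c).
  have -> : (fun f => g f ord0 c) = (fun f => \sum_i (f i).1 * (f i).2 ord0 c).
    by apply/funext => f; rewrite summxE; apply: eq_bigr => i _; rewrite mxE.
  apply: (@continuous_sum R _ _ _ (fun i (f : T) => (f i).1 * (f i).2 ord0 c)) => i.
  exact: (@continuous_mul R T).
have [f Af fmin] : exists2 f, A f &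
    forall h, A h -> dotv (g f) (g f) <= dotv (g h) (g h).
  apply: compact_min cA _; first by have [f Af _] := Ag _ z0X; exists f.
  apply: (@continuous_sum R _ _ _ (fun c (f : T) => g f ord0 c * g f ord0 c)) => c.
  exact: (@continuous_mul R T).
by exists (g f) => [|_ /Ag[h Ah ->]]; [exact: gA|exact: fmin].
Qed.

(** * A nonzero point of least norm contradicts convexity of the images *)

Section MinimalJoin.
Variables (R : realType) (n q : nat) (X : 'I_q.+1 -> set 'rV[R]_n) (p : 'rV[R]_n).
Hypothesis p_min : forall z, join X z -> dotv p p <= dotv z z.
Hypothesis p_neq0 : p != 0.
Hypothesis X0 : forall i, conv_hull (X i) 0.

Lemma minimal_segment y : dotv y p <= 0 ->
  ~ (forall s, 0 <= s <= 1 -> join X ((1 - s) *: p + s *: y)).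
Proof.
move=> yp h; have P0 := dotvv_gt0 p_neq0; have Y0 := dotvv_ge0 y.
set P := dotv p p in P0 *; set Y := dotv y y in Y0 *.
have PY : 0 < P + Y by rewrite ltr_pwDl.
(* This is the minimiser of the squared norm on the segment when [dotv y p] is zero; a negative
   value only helps. The squared norm drops by at least [s * P]. *)
pose s := P / (P + Y).
have s0 : 0 < s by rewrite divr_gt0.
have s1 : s <= 1 by rewrite ler_pdivrMr// mul1r lerDl.
have sE : s * (P + Y) = P by rewrite /s mulfVK ?gt_eqF.
have s01 : 0 <= s <= 1 by rewrite ltW.
have := p_min (h s s01).
rewrite dotvDl !dotvZl ![dotv _ (_ + _)]dotvC !dotvDl !dotvZl (dotvC p y) -/P -/Y.
have -> : (1 - s) * ((1 - s) * P + s * dotv y p) + s * ((1 - s) * dotv y p + s * Y)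
   = P - s * P + s * (s * (P + Y) - P) + 2 * (s * (1 - s) * dotv y p) by ring.
have : s * (1 - s) * dotv y p <= 0
  by rewrite mulr_ge0_le0// mulr_ge0 ?subr_ge0// ltW.
have : 0 < s * P by rewrite mulr_gt0.
by rewrite sE subrr mulr0; lra.
Qed.

Lemma minimal_weight_gt0 (t : 'I_q.+1 -> R) (x : 'I_q.+1 -> 'rV[R]_n) :
  (forall i, 0 <= t i) -> \sum_i t i = 1 -> (forall i, X i (x i)) ->
  p = \sum_i t i *: x i -> forall i, 0 < t i.
Proof.
move=> t_ge0 t1 xX pE i.
rewrite lt_neqAle t_ge0 andbT eq_sym; apply/eqP => ti.
have [y yX yp] := conv_hull_halfspace p (X0 i).
apply: (minimal_segment yp) => s /andP[s0 s1].
(* The idle slot [i] carries [y] with weight [s], and the other weights are scaled by [1 - s]. *)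
exists (fun j => if j == i then s else (1 - s) * t j),
  (fun j => if j == i then y else x j).
split.
- by move=> j; case: eqP => // _; rewrite mulr_ge0// subr_ge0.
- rewrite (bigD1 i)//= eqxx.
  have -> : \sum_(j < q.+1 | j != i) (if j == i then s else (1 - s) * t j) = 1 - s.
    move: t1; rewrite (bigD1 i)//= ti add0r => t1';
      rewrite -[RHS]mulr1 -t1' mulr_sumr.
    by apply: eq_bigr => j /negbTE ->.
  by rewrite addrCA subrr addr0.
- by move=> j; case: eqP => [->|].
rewrite pE (bigD1 i)//= ti scale0r add0r [in RHS](bigD1 i)//= eqxx addrC.
congr (_ + _); rewrite scaler_sumr; apply: eq_bigr => j /negbTE ->.
by rewrite scalerA.
Qed.

Variables (t : 'I_q.+1 -> R) (x : 'I_q.+1 -> 'rV[R]_n).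
Hypotheses (t_ge0 : forall i, 0 <= t i) (t1 : \sum_i t i = 1).
Hypotheses (xX : forall i, X i (x i)) (pE : p = \sum_i t i *: x i).

(* Caratheodory's argument: an affine dependency would allow one of the
   weights of [p] to be moved to zero. *)
Lemma minimal_affine_free (a : 'I_q.+1 -> R) :
  \sum_i a i = 0 -> \sum_i a i *: x i = 0 -> forall i, a i = 0.
Proof.
move=> a0 ax i; apply: contrapT => /eqP ai.
have [j0 aj0] : exists j, 0 < a j.
  apply: contrapT => no; have a_le0 j : a j <= 0.
    by rewrite leNgt; apply/negP => aj; apply: no; exists j.
  have : \sum_j - a j = 0 by rewrite sumrN a0 oppr0.
  move/eqP; rewrite psumr_eq0 => [/allP/(_ i (mem_index_enum _))|j _].
    by rewrite oppr_eq0 (negbTE ai).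
  by rewrite oppr_ge0.
(* The least ratio is the largest multiple of [a] that can be subtracted from [t] with all weights
   staying nonnegative; it brings weight [j] to zero. *)
have [j aj jmin] := Order.TotalTheory.arg_minP (P := fun j => 0 < a j)
  (fun j => t j / a j) aj0.
pose l := t j / a j.
have l0 : 0 <= l by rewrite divr_ge0// ltW.
pose t' k := t k - l * a k.
have t'0 k : 0 <= t' k.
  rewrite subr_ge0; have [ak|ak] := ltP 0 (a k).
    by rewrite -ler_pdivlMr// jmin.
  by rewrite (le_trans _ (t_ge0 k))// mulr_ge0_le0.
have : 0 < t' j.
  apply: (@minimal_weight_gt0 t' x) => //.
    by rewrite big_split /= sumrN -mulr_sumr a0 mulr0 subr0.
  rewrite pE; transitivity (\sum_i t i *: x i - l *: \sum_i a i *: x i).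
    by rewrite ax scaler0 subr0.
  by rewrite scaler_sumr -sumrB; apply: eq_bigr => k _; rewrite scalerBl scalerA.
by rewrite /t' /l divfK ?gt_eqF// subrr ltxx.
Qed.

Definition edge_mx : 'M[R]_(q, n) := \matrix_(i < q) (x (lift ord0 i) - x ord0).

(** This translates the row space of [edge_mx] into combinations of the [x i] with coefficient sum
    zero; [x ord0] receives minus the sum of [u]. *)
Lemma edge_mx_comb (u : 'rV[R]_q) :
  exists2 a : 'I_q.+1 -> R, \sum_i a i = 0 &
    u *m edge_mx = \sum_i a i *: x i /\ forall i, a (lift ord0 i) = u ord0 i.
Proof.
pose a i := if unlift ord0 i is Some j then u ord0 j else - \sum_j u ord0 j.
have aS i : a (lift ord0 i) = u ord0 i by rewrite /a liftK.
have a0 : a ord0 = - \sum_j u ord0 j by rewrite /a unlift_none.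
exists a; first by rewrite big_ord_recl a0;
  under [X in _ + X]eq_bigr do rewrite aS; exact: addNr.
split=> //; rewrite big_ord_recl a0; under [X in _ = _ + X]eq_bigr do rewrite aS.
rewrite mulmx_sum_row scaleNr scaler_suml addrC -sumrB; apply: eq_bigr => i _.
by rewrite rowK scalerBr.
Qed.

(** A vector in the left kernel is an affine dependency of the [x i], hence zero. The row space thus
    has codimension [n - q], the dimension of the images known to be convex. *)
Lemma edge_mx_rank : \rank edge_mx = q.
Proof.
apply/eqP; rewrite -[_ == _]/(row_free edge_mx) -kermx_eq0;
  apply/eqP/row_matrixP => i.
rewrite row0; have : row i (kermx edge_mx) *m edge_mx = 0
  by rewrite -row_mul mulmx_ker row0.
move: (row i _) => u ux; have [a a0 [ax au]] := edge_mx_comb u.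
by apply/rowP => j; rewrite -au mxE (minimal_affine_free a0)// -ax.
Qed.

Lemma mconvex_meets_edges (Y : set 'rV[R]_n) :
  m_convex (n - q) Y -> conv_hull Y 0 ->
  exists2 y, Y y & exists2 a : 'I_q.+1 -> R, \sum_i a i = 0 & y = \sum_i a i *: x i.
Proof.
have [M MP] : exists M : 'M[R]_(n, n - q),
    forall u : 'rV_n, u *m M = 0 -> (u <= edge_mx)%MS.
  (* The column base of the cokernel has the same left kernel as the cokernel, namely the edge
     space, but only [n - q] columns. *)
  have : exists M : 'M[R]_(n, \rank (cokermx edge_mx)),
      forall u : 'rV_n, u *m M = 0 -> (u <= edge_mx)%MS.
    exists (col_base (cokermx edge_mx)) => u u0.
    by rewrite submxE -[cokermx _]mulmx_base mulmxA u0 mul0mx.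
  by rewrite mxrank_coker edge_mx_rank.
move=> cY [m [s [y [s0 s1 yY yE]]]].
have [z zY /= z0] : (mulmxr M @` Y) 0.
  apply: (convexS_conv_hull (cY (mulmxr M))).
  exists m, s, (fun i => mulmxr M (y i)); split=> //.
    by move=> i; exists (y i).
  by rewrite -[LHS](linear0 (mulmxr M)) yE linear_sum; apply: eq_bigr => i _;
    rewrite linearZ.
have /submxP[u zE] := MP _ z0; have [a a0 [ax _]] := edge_mx_comb u.
by exists z => //; exists a => //; rewrite zE.
Qed.

Lemma minimal_join_not_mconvex : (forall i, m_convex (n - q) (X i)) -> False.
Proof.
move=> cX.
have /choice[A AP] : forall i, exists a : 'I_q.+1 -> R,
    \sum_j a j = 0 /\ X i (\sum_j a j *: x j).
  by move=> i; have [y yX [a a0 yE]] := mconvex_meets_edges (cX i) (X0 i);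
    exists a; rewrite -yE.
have t_gt0 := minimal_weight_gt0 t_ge0 t1 xX pE.
(* Row [k] of [A] holds the coefficients of the point chosen in [X k], hence the transposition.
   Dividing by [t i] makes [t i * b i] the coefficient of [x i] in the combination of these points
   with weights [z]. *)
have [z [z0 z1 zmax]] := symmetric_equilibrium (fun i j => A j i / t i).
pose b i := \sum_k A k i / t i * z k.
have tb i : t i * b i = \sum_k z k * A k i.
  rewrite /b mulr_sumr; apply: eq_bigr => k _.
  by rewrite mulrA mulrCA divff ?gt_eqF// mulr1 mulrC.
have [i0 zi0] := weight_gt0_ex z1.
pose s := b i0.
have bs i : b i <= s := zmax i0 i zi0.
have bz i : 0 < z i -> b i = s.
  by move=> zi; apply/eqP; rewrite eq_le bs; exact: zmax.
have sum_tb : \sum_i t i * b i = 0.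
  under eq_bigr do rewrite tb; rewrite exchange_big /= big1// => k _.
  by rewrite -mulr_sumr (AP k).1 mulr0.
(* The value [s] is at least the [t]-weighted average of the [b i], which is zero. *)
have s0 : 0 <= s.
  rewrite -sum_tb -[leRHS]mul1r -t1 mulr_suml; apply: ler_sum => i _.
  exact: ler_wpM2l.
(* These weights complete [t i * b i] to [s * t i]. They vanish wherever [z] is positive, so each
   [X i] contributes a single point, [y i] or [x i]. *)
pose w i := t i * (s - b i).
have w0 i : 0 <= w i by rewrite mulr_ge0// subr_ge0.
have wz i : 0 < z i -> w i = 0 by move=> /bz bi; rewrite /w bi subrr mulr0.
have w1 : \sum_i w i = s.
  rewrite /w; under eq_bigr do rewrite mulrBr;
    rewrite sumrB sum_tb subr0 -mulr_suml t1 mul1r //.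
pose y i := \sum_j A i j *: x j.
have s1 : 0 < 1 + s by rewrite ltr_pwDl.
have zj : join X ((s / (1 + s)) *: p).
  exists (fun i => (w i + z i) / (1 + s)),
    (fun i => if 0 < z i then y i else x i); split.
  - by move=> i; rewrite divr_ge0 ?addr_ge0// ltW.
  - by rewrite -mulr_suml big_split /= w1 z1 addrC divff ?gt_eqF.
  - by move=> i; case: ifP => // _; exact: (AP i).2.
  transitivity ((1 + s)^-1 *: (\sum_i w i *: x i + \sum_i z i *: y i)); last first.
    rewrite -big_split scaler_sumr; apply: eq_bigr => i _ /=.
    rewrite mulrC -[in RHS]scalerA; congr (_ *: _); case: ifP => zi.
      by rewrite wz// scale0r !add0r.
    have -> : z i = 0 by apply/eqP; rewrite eq_le z0 andbT leNgt zi.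
    by rewrite scale0r !addr0.
  rewrite mulrC -scalerA; congr (_ *: _).
  have -> : \sum_i z i *: y i = \sum_i (t i * b i) *: x i.
    under eq_bigr do rewrite scaler_sumr.
    rewrite exchange_big /=; apply: eq_bigr => j _; rewrite tb scaler_suml.
    by apply: eq_bigr => k _; rewrite scalerA.
  rewrite -big_split pE scaler_sumr; apply: eq_bigr => i _ /=.
  by rewrite -scalerDl /w mulrBr subrK scalerA mulrC.
have := p_min zj; rewrite dotvZl dotvC dotvZl.
have P0 := dotvv_gt0 p_neq0; set r := s / (1 + s).
have r0 : 0 <= r by rewrite divr_ge0// ltW.
have r1 : r < 1 by rewrite ltr_pdivrMr// mul1r ltrDr.
rewrite mulrA -[leLHS]mul1r ler_pM2r// leNgt => /negP; apply.
by rewrite -[ltRHS]mulr1 ltr_pM.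
Qed.
End MinimalJoin.

Theorem theorem4p3 (R : realType) (n k : nat) (hkn : (k <= n)%N)
    (X : 'I_k.+1 -> set 'rV[R]_n) :
  (forall i, compact (X i)) ->
  (forall i, m_convex (n - k)%N (X i)) ->
  (forall i, conv_hull (X i) 0) ->
  join X 0.
Proof.
move=> cX mX X0.
have Xx i : exists x, X i x.
  (* Only nonemptiness of [X i] is extracted here, so the normal vector is taken to be zero. *)
  by have [y yX _] := conv_hull_halfspace 0 (X0 i); exists y.
have [x xX] := choice Xx.
have XN0 : join X !=set0.
  exists (\sum_i (i == ord0)%:R *: x i), (fun i => (i == ord0)%:R), x; split => //.
  by rewrite (bigD1 ord0)//= big1 ?addr0// => i /negbTE->.
have [p pX p_min] := join_min cX XN0.
have [<-//|p0] := eqVneq p 0.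
have [t [y [t0 t1 yX pE]]] := pX.
by case: (minimal_join_not_mconvex p_min p0 X0 t0 t1 yX pE mX).
Qed.
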